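(* Let $S_a$ be a non-singular subdivision scheme on $\mathbb{Z}^s$ with dilation matrix $mI$, $|m|\ge2$, that generates linear polynomials, i.e. whose symbol $a(z)$ satisfies Condition $Z_2$: $a(\mathbf 1)=|m|^s$ and $(D^j a)(\varepsilon)=0$ for all $\varepsilon\in\Xi'$ and all $j\in\mathbb{N}_0^s$ with $|j|<2$. Let its parameter values be of the form $t_\alpha^{(r)}=t_0^{(r)}+\alpha/m^r$, $t_0^{(r)}=t_0^{(r-1)}-\tau/m^r$, $t_0^{(0)}=0$, with $\tau\in\mathbb{R}^s$. Then $S_a$ reproduces linear polynomials (i.e. reproduces polynomials of degree up to $1$) if and only if $$\tau=|m|^{-s}\bigl(D^{\epsilon_1}a(\mathbf 1),\dots,D^{\epsilon_s}a(\mathbf 1)\bigr),$$ where $\epsilon_i$ is the $i$-th standard unit vector, so that $D^{\epsilon_i}=\partial/\partial z_i$.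
   Context: Fix $s\ge 1$ and an integer $m$ with $|m|\ge 2$. A mask is a finitely supported sequence $a=\{a_\alpha\in\mathbb{R}:\alpha\in\mathbb{Z}^s\}$. Its symbol is the Laurent polynomial $a(z)=\sum_{\alpha\in\mathbb{Z}^s}a_\alpha z^\alpha$, $z\in(\mathbb{C}\setminus\{0\})^s$, where $z^\alpha=z_1^{\alpha_1}\cdots z_s^{\alpha_s}$. Let $\ell(\mathbb{Z}^s)$ be the space of all real sequences indexed by $\mathbb{Z}^s$. The subdivision operator is $(S_a d)_\alpha=\sum_{\beta\in\mathbb{Z}^s}a_{\alpha-m\beta}\,d_\beta$ for $d\in\ell(\mathbb{Z}^s)$. The subdivision scheme $S_a$ is the recursion $d^{(r+1)}=S_a d^{(r)}$, $r\ge 0$, $d^{(0)}\in\ell(\mathbb{Z}^s)$. Parameter values: for $\tau\in\mathbb{R}^s$, the parameter values are the points $t_\alpha^{(r)}=t_0^{(r)}+\alpha/m^r\in\mathbb{R}^s$ ($\alpha\in\mathbb{Z}^s$, $r\ge 0$), where $t_0^{(0)}=0$ and $t_0^{(r)}=t_0^{(r-1)}-\tau/m^r$ for $r\ge 1$. The datum $d_\alpha^{(r)}$ is attached to the point $t_\alpha^{(r)}$. Convergence: for initial data $d=d^{(0)}$ the scheme has limit function $g_d$ if there are continuous functions $F^{(r)}:\mathbb{R}^s\to\mathbb{R}$ with $F^{(r)}(t_\alpha^{(r)})=d_\alpha^{(r)}$ for all $\alpha\in\mathbb{Z}^s$, $r\ge 0$, which converge uniformly on compact sets to $g_d$ as $r\to\infty$.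 One writes $S_a^\infty d=g_d$. The scheme is convergent if a limit function exists for every $d\in\ell(\mathbb{Z}^s)$. It is non-singular if it is convergent and $g_d=0$ if and only if $d$ is the zero sequence. Reproduction: let $\Pi_k$ be the space of real polynomials on $\mathbb{R}^s$ of total degree at most $k$. A convergent scheme with parameter values $\{t^{(r)}\}$ reproduces polynomials of degree up to $k$ if for every $\pi\in\Pi_k$ and initial data $p^{(0)}_\alpha=\pi(t^{(0)}_\alpha)$, $\alpha\in\mathbb{Z}^s$, one has $S_a^\infty p^{(0)}=\pi$. Further notation: $D^j$, $j\in\mathbb{N}_0^s$, is the partial derivative of multi-order $j$, and $|j|=j_1+\dots+j_s$. Put $\mathbf 1=(1,\dots,1)$, $E=\{0,\dots,|m|-1\}^s$, $\Xi=\{(e^{-2\pi i e_1/m},\dots,e^{-2\pi i e_s/m}): (e_1,\dots,e_s)\in E\}$ and $\Xi'=\Xi\setminus\{\mathbf 1\}$. *)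

(* Defs.v *)
From HB Require Import structures.
From mathcomp Require Import all_boot all_order all_algebra.
(* The notations of [mpoly] clash with those of MathComp-Analysis. *)
From mathcomp Require Import (canonicals, coercions) mpoly.
From mathcomp Require Import all_classical all_reals all_analysis.
From mathcomp Require Import complex.

Set Implicit Arguments.
Unset Strict Implicit.
Unset Printing Implicit Defensive.

Import Order.TTheory GRing.Theory Num.Theory.
Import numFieldNormedType.Exports.

Local Open Scope classical_set_scope.
Local Open Scope complex_scope.
Local Open Scope ring_scope.

(* The derivative [D^j], with partial derivatives taken one at a time; their
   order is immaterial for Laurent polynomials on (K \ {0})^s. *)
Definition partial (K : numFieldType) (s : nat) (j : 'I_s -> nat)
    (f : 'rV[K]_s -> K) : 'rV[K]_s -> K :=
  foldr (fun i g => iter (j i) (fun h x => 'D_(delta_mx 0 i) h x) g) f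
        (enum 'I_s).

Section Subdivision.
Variables (R : realType) (s : nat).

Notation lattice := 'rV[int]_s.

Definition finitely_supported (a : lattice -> R) : Prop :=
  finite_set [set alpha | a alpha != 0].

(* As a function on all of C^s; the values at points with a vanishing
   coordinate are irrelevant, as is the value for infinitely supported [a].
   The powers of [z] have integer exponents. *)
Definition symbol (a : lattice -> R) (z : 'rV[R[i]]_s) : R[i] :=
  \sum_(alpha \in [set: lattice])
     (a alpha)%:C * \prod_(i < s) (z 0 i ^ alpha 0 i).

Definition subdivision (m : int) (a d : lattice -> R) : lattice -> R :=
  fun alpha => \sum_(beta \in [set: lattice]) a (alpha - m *: beta) * d beta.

Fixpoint param_origin (m : int) (tau : 'rV[R]_s) (r : nat) : 'rV[R]_s :=
  if r is r'.+1 then param_origin m tau r' - (m%:~R ^- r) *: tau else 0.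

Definition param (m : int) (tau : 'rV[R]_s) (r : nat) (alpha : lattice) :
    'rV[R]_s :=
  param_origin m tau r + (m%:~R ^- r) *: map_mx intr alpha.

(* [has_limit m a tau d g] is "S_a^oo d = g".  As the points
   [param m tau r alpha] get dense when 2 <= |m|, there is at most one such
   [g]. *)
Definition has_limit (m : int) (a : lattice -> R) (tau : 'rV[R]_s)
    (d : lattice -> R) (g : 'rV[R]_s -> R) : Prop :=
  exists F : nat -> 'rV[R]_s -> R,
    [/\ forall r, continuous (F r),
        forall r alpha,
          F r (param m tau r alpha) = iter r (subdivision m a) d alpha
      & {family compact, F @ \oo --> g}].

Definition convergent (m : int) (a : lattice -> R) (tau : 'rV[R]_s) : Prop :=
  forall d, exists g, has_limit m a tau d g.

Definition non_singular (m : int) (a : lattice -> R) (tau : 'rV[R]_s) : Prop :=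
  convergent m a tau /\
  forall d g, has_limit m a tau d g ->
    ((forall x, g x = 0) <-> (forall alpha, d alpha = 0)).

(* [mpoly.msize p] is the total degree plus one (and 0 if [p = 0]). *)
Definition Pi (k : nat) : set ('rV[R]_s -> R) :=
  [set f | exists p : mpoly.mpoly s R,
     (mpoly.msize p <= k.+1)%N /\
     forall x : 'rV[R]_s, f x = mpoly.meval (fun i => x 0 i) p].

Definition reproduces (k : nat) (m : int) (a : lattice -> R)
    (tau : 'rV[R]_s) : Prop :=
  convergent m a tau /\
  forall f, Pi k f -> has_limit m a tau (fun alpha => f (param m tau 0 alpha)) f.

Definition unit_index (i : 'I_s) : 'I_s -> nat := fun k => (k == i)%N.

Definition expi (t : R) : R[i] := cos t +i* sin t.

Definition Xi (m : int) : set 'rV[R[i]]_s :=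
  [set \row_i expi (- (2 * pi * (e i)%:R / m%:~R)) | e in
     [set: 'I_s -> 'I_`|m|%N]].

Definition Xi' (m : int) : set 'rV[R[i]]_s := Xi m `\ const_mx 1.

Definition condition_Z (k : nat) (m : int) (a : lattice -> R) : Prop :=
  symbol a (const_mx 1) = `|m|%N%:R ^+ s /\
  forall eps (j : 'I_s -> nat), Xi' m eps -> (\sum_i j i < k)%N ->
    partial j (symbol a) eps = 0.

End Subdivision.

(* Main.v *)
Require Import Defs.
From HB Require Import structures.
From mathcomp Require Import all_boot all_order all_algebra.
From mathcomp Require Import (canonicals, coercions) mpoly.
From mathcomp Require Import all_classical all_reals all_analysis.
From mathcomp Require Import complex.
From mathcomp Require Import ring lra.

Import Order.TTheory GRing.Theory Num.Theory.
Import numFieldNormedType.Exports.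

Local Open Scope complex_scope.
Local Open Scope ring_scope.

(** For a linear polynomial [f], one subdivision step only involves the mask
through its residue classes modulo [m]: writing [beta = (alpha - delta) / m],
the new datum at [alpha] is a combination of values of [f] in which the weight
[a delta] is attached to the displacement [delta], with [delta] running over
the class of [alpha].  So all that matters is the mass and the first moment of
[a] on each class.  Fourier inversion on [(Z/m)^s] expresses these by the
symbol and its gradient at the points of [Xi] ([coset_sum_Xi]); Condition [Z_2]
kills every frequency except [1], so each class has mass [1] ([coset_sum0]) and
the same first moment ([coset_sum1]), namely the vector [barycenter m a].  The
right-hand side of the theorem is exactly that vector ([barycenterE]).

Consequently, starting from the samples of [f] at the integer points, the data
after [r] steps are the values of [f] at the parameter points built from the
shift [c := barycenter m a], whatever [tau] is ([iter_subdivision_affine]).  If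
[tau = c], these are the values of [f] at the actual parameter points, so the
constant sequence [F r = f] witnesses that the limit is [f]
([barycenter_reproduces1]).

Conversely, the data after [r] steps are attached to the points built from
[tau].  The origins of the two grids of level [r] are
[(m^-r - 1) / (m - 1)] times [tau] and [c] ([param_originE]), hence stay in a
compact set, and if a coordinate of [tau] differs from that of [c], then the
corresponding coordinates of the two origins stay apart for all [r >= 1].  This
contradicts uniform convergence on compact sets to that coordinate function,
which is a polynomial of degree one ([reproduces1_barycenter]). *)

Set Implicit Arguments.
Unset Strict Implicit.
Unset Printing Implicit Defensive.

(** * Derivatives of Laurent monomials *)

Definition monomial {K : fieldType} {s : nat} (alpha : 'rV[int]_s)
    (z : 'rV[K]_s) : K :=
  \prod_(k < s) z 0 k ^ alpha 0 k.

(** The right factor is the logarithmic derivative; this form is the same for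
    positive, zero and negative exponents. *)
Lemma is_derive_coordXz (K : numFieldType) (s : nat) (x v : 'rV[K]_s)
    (k : 'I_s) (n : int) : x 0 k != 0 ->
  is_derive x v (fun z : 'rV[K]_s => z 0 k ^ n : K)
    (x 0 k ^ n * (n%:~R * (v 0 k / x 0 k))).
Proof.
move=> xk0.
have d1 : is_derive x v (fun z : 'rV[K]_s => z 0 k : K) (v 0 k).
  apply: DeriveDef; first exact/diff_derivable/differentiable_coord.
  rewrite deriveE; last exact: differentiable_coord.
  have lin : linear (fun z : 'rV[K]_s => z 0 k : K^o).
    by move=> c y z; rewrite !mxE.
  pose fL := GRing.isLinear.Build _ _ _ _ _ lin.
  pose f : {linear 'rV[K]_s -> K^o} := HB.pack (fun z : 'rV[K]_s => z 0 k) fL.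
  rewrite (_ : (fun _ => _) = f) // diff_lin //.
  exact: coord_continuous.
have dX p : is_derive x v (fun z : 'rV[K]_s => z 0 k ^+ p : K)
              (x 0 k ^+ p * (p%:R * (v 0 k / x 0 k))).
  rewrite (_ : (fun _ => _) = (fun z : 'rV[K]_s => z 0 k : K) ^+ p).
    apply: (is_derive_eq (is_deriveX p d1)); rewrite /GRing.scale /=.
    case: p => [|p]; first by rewrite !mul0r mulr0.
    by rewrite /= exprSr; field.
  by apply/funext => z; rewrite exprfctE.
case: n => p; first exact: dX.
have dXp := @ex_derive _ _ _ _ _ _ _ (dX p.+1).
have xp0 := expf_neq0 p.+1 xk0.
apply: DeriveDef; first exact: derivableV.
rewrite deriveV //.
rewrite (@derive_val _ _ _ _ _ _ _ (dX p.+1)) /GRing.scale /= NegzE -exprnN.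
have := expf_neq0 p xk0.
by rewrite !exprS => ?; field; apply/andP.
Qed.

(** Written with logarithmic derivatives, the product rule is a sum. *)
Lemma is_derive_prod_log (K : numFieldType) (V : normedModType K) (I : Type)
    (r : seq I) (f : I -> V -> K) (l : I -> K) (x v : V) :
  (forall k, is_derive x v (f k) (f k x * l k)) ->
  is_derive x v (fun z => \prod_(k <- r) f k z)
    ((\prod_(k <- r) f k x) * \sum_(k <- r) l k).
Proof.
move=> df; elim: r => [|k r IHr].
  rewrite !big_nil mulr0 (_ : (fun _ => _) = cst 1); last first.
    by apply/funext => z; rewrite big_nil.
  exact: is_derive_cst.
rewrite (_ : (fun _ => _) = f k * (fun z => \prod_(j <- r) f j z)); last first.
  by apply/funext => z; rewrite big_cons.
apply: is_derive_eq.
by rewrite !big_cons /GRing.scale /=; ring.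
Qed.

Lemma is_derive_monomial (K : numFieldType) (s : nat) (alpha : 'rV[int]_s)
    (i : 'I_s) (x : 'rV[K]_s) : (forall k, x 0 k != 0) ->
  is_derive x (delta_mx 0 i) (monomial alpha)
    (monomial alpha x * ((alpha 0 i)%:~R / x 0 i)).
Proof.
move=> x0; apply: is_derive_eq.
  by apply: is_derive_prod_log => k; exact: is_derive_coordXz.
congr (_ * _); rewrite (bigD1 i) //= big1 => [|k ki].
  by rewrite mxE !eqxx /= addr0 mul1r.
by rewrite mxE (negbTE ki) /= mul0r mulr0.
Qed.

Lemma partial0 (K : numFieldType) (s : nat) (f : 'rV[K]_s -> K) :
  partial (fun=> 0%N) f = f.
Proof. by rewrite /partial; elim: (enum 'I_s). Qed.

Lemma partial_unit (K : numFieldType) (s : nat) (i : 'I_s)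
    (f : 'rV[K]_s -> K) x :
  partial (unit_index i) f x = 'D_(delta_mx 0 i) f x.
Proof.
rewrite /partial /unit_index.
suff -> : foldr (fun k g => iter (k == i) (fun h y => 'D_(delta_mx 0 k) h y) g)
     f (enum 'I_s) = if i \in enum 'I_s then fun y => 'D_(delta_mx 0 i) f y else f.
  by rewrite mem_enum.
elim: (enum 'I_s) (enum_uniq 'I_s) => //= k l IHl /andP[kl ul].
by rewrite IHl // in_cons; case: (eqVneq i k) kl => [<- /negbTE -> //|].
Qed.

(** * Roots of unity *)

Lemma expiD (R : realType) (x y : R) : expi (x + y) = expi x * expi y.
Proof. by rewrite /expi cosD sinD; simpc; congr (_ +i* _); rewrite addrC. Qed.

Lemma expiN (R : realType) (x : R) : expi (- x) = (expi x)^-1.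
Proof.
have h : expi x * expi (- x) = 1 by rewrite -expiD subrr /expi cos0 sin0.
have x0 : expi x != 0.
  by apply/eqP => x0; move/eqP: h; rewrite x0 mul0r eq_sym oner_eq0.
by apply: (mulfI x0); rewrite h mulfV.
Qed.

Lemma expiMn (R : realType) (x : R) n : expi (x *+ n) = expi x ^+ n.
Proof.
elim: n => [|n IHn]; first by rewrite mulr0n expr0 /expi cos0 sin0.
by rewrite mulrS exprS expiD IHn.
Qed.

(** Half angles turn [cos x = 1] into [sin (x / 2) = 0]. *)
Lemma expi_neq1 (R : realType) (x : R) : 0 < x < 2 * pi -> expi x != 1.
Proof.
move=> /andP[x0 xpi]; apply/negP => /eqP[+ _].
have -> : x = x / 2 + x / 2 by field.
rewrite cosD -!expr2 => c1.
have s0 : 0 < sin (x / 2) by apply: sin_gt0_pi; apply/andP; split; lra.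
have := cos2Dsin2 (x / 2); nra.
Qed.

(** The sign of [m] only replaces the root of unity by its inverse, so everything
    is reduced to the angle [2 pi / |m|]. *)
Lemma expi_prim_root (R : realType) (m : int) : m != 0 ->
  `|m|%N.-primitive_root (expi (- (2 * pi / m%:~R : R))).
Proof.
move=> m0; have M0 : (0 < `|m|)%N by rewrite absz_gt0.
have mR : (m%:~R : R) = (-1) ^+ (m < 0)%R * `|m|%N%:R.
  by rewrite {1}[m]intEsign rmorphM /= rmorphXn /= rmorphN1.
have MR : (0 : R) < `|m|%N%:R by rewrite ltr0n.
pose x : R := 2 * pi / `|m|%N%:R.
have xE n : expi (- (2 * pi / m%:~R : R)) ^+ n = expi (x *+ n) \/
            expi (- (2 * pi / m%:~R : R)) ^+ n = (expi (x *+ n))^-1.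
  rewrite mR -expiMn; case: (m < 0); [left|right].
    by congr (expi (_ *+ n)); rewrite /x; field; rewrite gt_eqF.
  rewrite -expiN -mulNrn; congr (expi (_ *+ n)); rewrite /x.
  by field; rewrite gt_eqF.
(* For [0 < i < |m|] the angle [x *+ i] lies strictly inside [(0, 2 pi)]. *)
apply/andP; split=> //; apply/forallP => -[i iM] /=.
rewrite unity_rootE; apply/eqP.
have xi : x *+ i.+1 = 2 * pi * (i.+1%:R / `|m|%N%:R).
  by rewrite /x -mulr_natr; field; rewrite gt_eqF.
case: (eqVneq i.+1 `|m|%N) => [eM|nM].
  have e1 : expi (x *+ i.+1) = 1.
    by rewrite xi eM divff ?gt_eqF // mulr1 mulr_natl /expi cos2pi sin2pi.
  by case: (xE i.+1) => ->; rewrite e1 ?invr1 eqxx.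
have : expi (x *+ i.+1) != 1.
  apply: expi_neq1; rewrite xi.
  have iM' : (i.+1 < `|m|)%N by rewrite ltn_neqAle nM.
  have pi0 := pi_gt0 R.
  apply/andP; split; first by rewrite mulr_gt0 ?divr_gt0 ?ltr0n // mulr_gt0.
  by rewrite -[ltRHS]mulr1 ltr_pM2l ?mulr_gt0 // ltr_pdivrMr // mul1r ltr_nat.
by case: (xE i.+1) => -> /negbTE; rewrite ?invr_eq1 => ->.
Qed.

Lemma prim_expz_eq1 (F : fieldType) (n : nat) (w : F) (k : int) :
  n.-primitive_root w -> (w ^ k == 1) = (n %| k)%Z.
Proof.
move=> pw; rewrite dvdzE /=; case: k => k; first by rewrite (prim_order_dvd pw).
by rewrite NegzE -exprnN invr_eq1 abszN (prim_order_dvd pw).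
Qed.

(** Orthogonality of the characters of the cyclic group of order [n]. *)
Lemma sum_prim_exprz (F : fieldType) (n : nat) (w : F) (k : int) :
  n.-primitive_root w ->
  \sum_(j < n) (w ^+ j) ^ k = if (n %| k)%Z then n%:R else 0.
Proof.
move=> pw; have wX j : (w ^+ j) ^ k = (w ^ k) ^+ j by exact: (exprzAC w j k).
under eq_bigr do rewrite wX.
rewrite -(prim_expz_eq1 k pw); case: eqVneq => [->|wk1].
  under eq_bigr do rewrite expr1n.
  by rewrite sumr_const card_ord.
have : (w ^ k - 1) * \sum_(j < n) (w ^ k) ^+ j = 0.
  by rewrite -subrX1 -wX (prim_expr_order pw) exp1rz subrr.
by move/eqP; rewrite mulf_eq0 subr_eq0 (negbTE wk1) => /eqP.
Qed.

(** * Sums over residue classes *)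

Definition congruent (s : nat) (m : int) (alpha delta : 'rV[int]_s) : bool :=
  [forall k, (m %| (delta 0 k - alpha 0 k)%R)%Z].

(** Fourier inversion on [(Z/m)^s]: the sum of [b] over a residue class is the
    average over the points [eps] of [Xi] of [eps^(-alpha)] times the transform
    of [b] at [eps], and by hypothesis only [eps = 1] contributes. *)
Lemma coset_sum_Xi (R : realType) (s : nat) (m : int) (m0 : m != 0)
    (b : 'rV[int]_s -> R[i]) (A : seq 'rV[int]_s) (alpha : 'rV[int]_s) :
  (forall eps, Xi' m eps -> \sum_(delta <- A) b delta * monomial delta eps = 0) ->
  \sum_(delta <- A | congruent m alpha delta) b delta =
  (`|m|%N%:R ^- s) * \sum_(delta <- A) b delta.
Proof.
move=> b0; set M := `|m|%N.
have M0 : (0 < M)%N by rewrite absz_gt0.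
pose w : R[i] := expi (- (2 * pi / m%:~R)).
have pw : M.-primitive_root w by exact: expi_prim_root.
have w0 : w != 0.
  apply/eqP => w0; have := prim_expr_order pw.
  by rewrite w0 expr0n gtn_eqF //= => /eqP; rewrite eq_sym oner_eq0.
pose eps (e : {ffun 'I_s -> 'I_M}) : 'rV[R[i]]_s := \row_k (w ^+ e k).
have epsXi e : Xi m (eps e).
  exists e => //; apply/rowP => k; rewrite !mxE -expiMn; congr expi.
  by rewrite -mulr_natr; ring.
pose e0 : {ffun 'I_s -> 'I_M} := [ffun=> Ordinal M0].
have eps1 e : (eps e == const_mx 1) = (e == e0).
  apply/eqP/eqP => [/rowP e1|->]; last by apply/rowP => k; rewrite !mxE ffunE.
  apply/ffunP => k; rewrite ffunE; apply/val_inj => /=.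
  have /eqP := e1 k; rewrite !mxE -(prim_order_dvd pw).
  by rewrite /dvdn modn_small // => /eqP.
have monoE delta e : monomial delta (eps e) = \prod_k (w ^+ e k) ^ delta 0 k.
  by apply: eq_bigr => k _; rewrite mxE.
have M0C : (M%:R : R[i]) != 0 by rewrite pnatr_eq0 -lt0n.
apply: (mulfI (expf_neq0 s M0C)); rewrite mulVKf ?expf_neq0 //.
(* The intermediate sum collapses on the right by the hypothesis on [b], and on
   the left by orthogonality of characters in each coordinate. *)
transitivity (\sum_(e : {ffun 'I_s -> 'I_M}) (\prod_k (w ^+ e k) ^ - alpha 0 k) *
                \sum_(delta <- A) b delta * monomial delta (eps e)); last first.
  rewrite (bigD1 e0) //= [X in _ + X]big1 ?addr0 => [|e ne0].
    rewrite big1 ?mul1r => [|k _]; last by rewrite ffunE expr0 exp1rz.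
    apply: eq_bigr => delta _; rewrite monoE big1 ?mulr1 // => k _.
    by rewrite ffunE expr0 exp1rz.
  by rewrite b0 ?mulr0 //; split=> //; apply/eqP; rewrite eps1.
under [RHS]eq_bigr do rewrite mulr_sumr.
rewrite exchange_big /= mulr_sumr big_mkcond /=; apply: eq_bigr => delta _.
transitivity (b delta * \sum_(e : {ffun 'I_s -> 'I_M})
                 \prod_k (w ^+ e k) ^ (delta 0 k - alpha 0 k)); last first.
  rewrite mulr_sumr; apply: eq_bigr => e _.
  rewrite mulrCA monoE; congr (_ * _); rewrite -big_split /=.
  by apply: eq_bigr => k _; rewrite -expfzDr ?expf_neq0 // addrC.
rewrite -(bigA_distr_bigA
  (fun k (j : 'I_M) => (w ^+ j) ^ (delta 0 k - alpha 0 k))).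
under [in RHS]eq_bigr do rewrite (sum_prim_exprz _ pw).
rewrite /congruent; case: ifPn => [/forallP cg|/forallPn[k ncg]].
  rewrite (eq_bigr (fun=> M%:R)) => [|k _]; last first.
    by have := cg k; rewrite !dvdzE => ->.
  by rewrite prodr_const card_ord mulrC.
rewrite (bigD1 k) //=; move: ncg; rewrite !dvdzE => /negbTE ->.
by rewrite mul0r mulr0.
Qed.

Definition supp (R : realType) (s : nat) (a : 'rV[int]_s -> R) :
    seq 'rV[int]_s :=
  finmap.enum_fset (fset_set [set alpha | a alpha != 0]%classic).

Lemma symbolE (R : realType) (s : nat) (a : 'rV[int]_s -> R) z :
  finitely_supported a ->
  symbol a z = \sum_(delta <- supp a) (a delta)%:C * monomial delta z.
Proof.
move=> ha; apply: fsbigTE => delta.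
rewrite in_fset_set // notin_setE /= => /negP; rewrite negbK => /eqP ->.
by rewrite mul0r.
Qed.

Lemma is_derive_lin_comb (K : numFieldType) (V : normedModType K) (I : Type)
    (r : seq I) (c : I -> K) (f : I -> V -> K) (df : I -> K) (x v : V) :
  (forall k, is_derive x v (f k) (df k)) ->
  is_derive x v (fun z => \sum_(k <- r) c k * f k z)
    (\sum_(k <- r) c k * df k).
Proof.
move=> dfk; elim: r => [|k r IHr].
  rewrite big_nil (_ : (fun _ => _) = cst 0); last first.
    by apply/funext => z; rewrite big_nil.
  exact: is_derive_cst.
rewrite big_cons (_ : (fun _ => _) =
  c k \*: f k + (fun z => \sum_(j <- r) c j * f j z)).
  exact: (is_deriveD (is_deriveZ _ (dfk k)) IHr).
by apply/funext => z; rewrite big_cons.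
Qed.

(** Up to the factor [1 / z_i], differentiating the symbol is passing to the
    symbol of the first moments of the mask. *)
Lemma derive_symbol (R : realType) (s : nat) (a : 'rV[int]_s -> R)
    (i : 'I_s) (z : 'rV[R[i]]_s) :
  finitely_supported a -> (forall k, z 0 k != 0) ->
  partial (unit_index i) (symbol a) z =
  (\sum_(delta <- supp a) (a delta * (delta 0 i)%:~R)%:C * monomial delta z)
    / z 0 i.
Proof.
move=> ha z0; rewrite partial_unit.
have -> : symbol a =
    fun z => \sum_(delta <- supp a) (a delta)%:C * monomial delta z.
  by apply/funext => y; exact: symbolE.
have := @is_derive_lin_comb _ _ _ (supp a) (fun delta => (a delta)%:C) _ _ z
  (delta_mx 0 i) (fun delta => is_derive_monomial delta i z0).
move=> /@derive_val ->; rewrite mulr_suml; apply: eq_bigr => delta _.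
by rewrite rmorphM /= rmorph_int; ring.
Qed.

Lemma monomial1 (K : fieldType) (s : nat) (delta : 'rV[int]_s) :
  monomial delta (const_mx 1 : 'rV[K]_s) = 1.
Proof. by rewrite /monomial big1 // => k _; rewrite mxE exp1rz. Qed.

(** Under Condition [Z_1] each residue class has mass [1], so this is the mean
    over the [|m|^s] classes of their first moments; under Condition [Z_2] it is
    the first moment of every class. *)
Definition barycenter (R : realType) (s : nat) (m : int) (a : 'rV[int]_s -> R) :
    'rV[R]_s :=
  \row_i (`|m|%N%:R ^- s * \sum_(delta <- supp a) a delta * (delta 0 i)%:~R).

Lemma barycenterE (R : realType) (s : nat) (m : int) (a : 'rV[int]_s -> R) :
  finitely_supported a ->
  (`|m|%N%:R ^- s) *: \row_(i < s) partial (unit_index i) (symbol a) (const_mx 1)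
  = map_mx (real_complex R) (barycenter m a).
Proof.
move=> ha; apply/rowP => i; rewrite !mxE derive_symbol => [|//|k]; last first.
  by rewrite mxE oner_eq0.
rewrite mxE divr1 rmorphM /= fmorphV rmorphXn /= rmorph_nat; congr (_ * _).
by rewrite rmorph_sum /=; apply: eq_bigr => delta _; rewrite monomial1 mulr1.
Qed.

Lemma Xi_neq0 (R : realType) (s : nat) (m : int) (eps : 'rV[R[i]]_s) k :
  Xi m eps -> eps 0 k != 0.
Proof.
move=> [e _ <-]; rewrite mxE; apply/eqP => e0.
have := @expiD R (- (2 * pi * (e k)%:R / m%:~R)) (2 * pi * (e k)%:R / m%:~R).
rewrite e0 mul0r addNr /expi cos0 sin0 => /eqP.
by rewrite oner_eq0.
Qed.

Lemma coset_sum0 (R : realType) (s : nat) (m : int) (a : 'rV[int]_s -> R)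
    (k : nat) (alpha : 'rV[int]_s) :
  m != 0 -> finitely_supported a -> (0 < k)%N -> condition_Z k m a ->
  \sum_(delta <- supp a | congruent m alpha delta) a delta = 1.
Proof.
move=> m0 ha k0 [Z1 Z0]; apply: (@fmorph_inj _ _ (real_complex R)).
have M0 : (`|m|%N%:R : R[i]) ^+ s != 0.
  by rewrite expf_neq0 // pnatr_eq0 absz_eq0.
rewrite rmorph_sum /= coset_sum_Xi //.
  rewrite -[RHS](mulVf M0) -Z1 symbolE //; congr (_ * _).
  by apply: eq_bigr => delta _; rewrite monomial1 mulr1.
move=> eps eX; rewrite -symbolE // -(Z0 eps (fun=> 0%N)) ?partial0 //.
by rewrite big1.
Qed.

Lemma coset_sum1 (R : realType) (s : nat) (m : int) (a : 'rV[int]_s -> R)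
    (k : nat) (alpha : 'rV[int]_s) (i : 'I_s) :
  m != 0 -> finitely_supported a -> (1 < k)%N -> condition_Z k m a ->
  \sum_(delta <- supp a | congruent m alpha delta) a delta * (delta 0 i)%:~R
  = barycenter m a 0 i.
Proof.
move=> m0 ha k1 [_ Z0]; apply: (@fmorph_inj _ _ (real_complex R)).
rewrite rmorph_sum /= coset_sum_Xi //.
  by rewrite mxE rmorphM /= fmorphV rmorphXn /= rmorph_nat rmorph_sum.
move=> eps eX; have eps0 j : eps 0 j != 0 by apply: Xi_neq0; exact: eX.1.
have := Z0 eps (unit_index i) eX; rewrite derive_symbol // => h.
apply/eqP; rewrite -(mulIr_eq0 _ (mulIf (invr_neq0 (eps0 i)))); apply/eqP/h.
rewrite (bigD1 i) //= big1 /unit_index ?eqxx //.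
by move=> j /negbTE ->.
Qed.

(** * Subdivision of affine data *)

(** The terms with nonzero weight are those where [delta := alpha - m *: beta]
    lies in the support, so indexing by [delta] makes the sum finite. *)
Lemma subdivisionE (R : realType) (s : nat) (m : int)
    (a d H : 'rV[int]_s -> R) (alpha : 'rV[int]_s) :
  m != 0 -> finitely_supported a ->
  (forall beta, d beta = H (alpha - m *: beta)) ->
  subdivision m a d alpha =
  \sum_(delta <- supp a | congruent m alpha delta) a delta * H delta.
Proof.
move=> m0 ha dH; rewrite /subdivision.
under eq_fsbigr do rewrite dH.
pose h (beta : 'rV[int]_s) : 'rV[int]_s := alpha - m *: beta.
have hinj : injective h.
  move=> x y /addrI /oppr_inj /rowP xy; apply/rowP => k.
  by have := xy k; rewrite !mxE => /(mulfI m0).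
have hrange delta : (delta \in range h) = congruent m alpha delta.
  apply/idP/forallP => [|cg].
    rewrite inE => -[beta _ <-] k; rewrite !mxE addrAC subrr add0r.
    by rewrite dvdzE abszN abszM dvdn_mulr.
  rewrite inE; exists (\row_k ((alpha 0 k - delta 0 k)%R %/ m)%Z) => //.
  apply/rowP => k; rewrite !mxE mulrC divzK ?subKr //.
  by rewrite -opprB dvdzE abszN; exact: cg.
rewrite -(@reindex_fsbig _ _ _ _ _ h setT (range h)
  (fun delta => a delta * H delta)).
  rewrite (@fsbigE _ _ _ _ _ [seq delta <- supp a | congruent m alpha delta]).
  - by rewrite big_filter_cond; apply: eq_bigl => delta; rewrite hrange andbb.
  - exact/filter_uniq/finmap.fset_uniq.
  - move=> delta /=; rewrite mem_filter => /andP[cg _].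
    by move: cg; rewrite -hrange inE.
  - move=> delta hd; rewrite mem_filter -hrange mem_set //=.
    rewrite in_fset_set // notin_setE /= => /negP; rewrite negbK => /eqP ->.
    by rewrite mul0r.
split => [x _|x y _ _|x [y _ <-]]; [by exists x | exact: hinj | by exists y].
Qed.

Definition affine (R : realType) (s : nat) (f : 'rV[R]_s -> R) : Prop :=
  exists (u : R) (v : 'I_s -> R), forall x, f x = u + \sum_i x 0 i * v i.

(** With [beta = (alpha - delta) / m], the value of [f] at the grid point of
    [beta] is a constant [P] minus a linear function of [delta]; averaging over
    the class of [alpha] replaces [delta] by [barycenter m a], which is the shift
    from the grid of level [r] to that of level [r.+1]. *)
Lemma subdivision_affine (R : realType) (s : nat) (m : int)
    (a : 'rV[int]_s -> R) (f : 'rV[R]_s -> R) (k r : nat) :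
  m != 0 -> finitely_supported a -> (1 < k)%N -> condition_Z k m a ->
  affine f ->
  subdivision m a (fun beta => f (param m (barycenter m a) r beta)) =
  fun alpha => f (param m (barycenter m a) r.+1 alpha).
Proof.
move=> m0 ha k1 hZ [u [v fE]]; apply/funext => alpha.
have mR : (m%:~R : R) != 0 by rewrite intr_eq0.
pose c := barycenter m a; pose q : R := m%:~R ^- r.+1.
pose P : R := u + \sum_i (param_origin m c r 0 i + q * (alpha 0 i)%:~R) * v i.
rewrite (@subdivisionE _ _ _ _ _
  (fun delta => P - q * \sum_i (delta 0 i)%:~R * v i)) //; last first.
  move=> beta; rewrite fE /P -addrA; congr (_ + _).
  rewrite mulr_sumr -sumrB; apply: eq_bigr => i _.
  rewrite !mxE !rmorphB !rmorphM /= /q exprS -/c.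
  by field; rewrite expf_neq0.
under eq_bigr do rewrite mulrBr.
rewrite sumrB -mulr_suml (coset_sum0 _ m0 ha (ltnW k1) hZ) mul1r.
rewrite fE /P -addrA; congr (_ + _).
transitivity (\sum_i (param_origin m c r 0 i + q * (alpha 0 i)%:~R) * v i -
              q * \sum_i c 0 i * v i).
  congr (_ - _).
  under eq_bigr do rewrite mulrCA.
  rewrite -mulr_sumr; congr (_ * _).
  under eq_bigr do rewrite mulr_sumr.
  rewrite exchange_big /=; apply: eq_bigr => i _.
  rewrite -(coset_sum1 alpha i m0 ha k1 hZ) mulr_suml.
  by apply: eq_bigr => delta _; rewrite mulrA.
rewrite mulr_sumr -sumrB; apply: eq_bigr => i _.
by rewrite !mxE -/c -/q; ring.
Qed.

(** At level [0] the parameter points are the integer points for every shift,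
    which is why [tau] does not appear on the right. *)
Lemma iter_subdivision_affine (R : realType) (s : nat) (m : int)
    (a : 'rV[int]_s -> R) (f : 'rV[R]_s -> R) (k : nat) (tau : 'rV[R]_s) r :
  m != 0 -> finitely_supported a -> (1 < k)%N -> condition_Z k m a ->
  affine f ->
  iter r (subdivision m a) (fun alpha => f (param m tau 0 alpha)) =
  fun alpha => f (param m (barycenter m a) r alpha).
Proof.
move=> m0 ha k1 hZ af; elim: r => [//|r IHr].
by rewrite iterS IHr (subdivision_affine _ m0 ha k1 hZ af).
Qed.

Lemma continuous_affine (R : realType) (s : nat) (f : 'rV[R]_s -> R) :
  affine f -> continuous f.
Proof.
move=> [u [v fE]].
have -> : f = cst u + \sum_i ((fun x : 'rV[R]_s => x 0 i : R) * cst (v i)).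
  by apply/funext => x; rewrite fE /= fctE fct_sumE.
move=> x; apply: differentiable_continuous; apply: differentiableD => //.
by apply: differentiable_sum => i; apply: differentiableM => //;
  exact: differentiable_coord.
Qed.

Lemma affine_Pi1 (R : realType) (s : nat) (f : 'rV[R]_s -> R) :
  Pi 1 f -> affine f.
Proof.
move=> [p [p2 fp]].
have := @mpoly.msize_mdeg_lt _ _ p.
suff : forall r : seq (mpoly.multinom s),
    (forall mu, mu \in r -> (mpoly.mdeg mu <= 1)%N) ->
    affine (fun x : 'rV[R]_s => \sum_(mu <- r) mpoly.mcoeff mu p *
      \prod_i x 0 i ^+ mpoly.fun_of_multinom mu i).
  move=> H dp.
  have [|u [v uv]] := H (mpoly.msupp p).
    by move=> mu /dp mup; rewrite -ltnS (leq_trans mup).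
  by exists u, v => x; rewrite fp mpoly.mevalE uv.
elim=> [_|mu r IHr dr].
  exists 0, (fun=> 0) => x; rewrite big_nil add0r big1 // => i _.
  by rewrite mulr0.
have [|u [v uv]] := IHr.
  by move=> nu nur; apply: dr; rewrite in_cons nur orbT.
have := dr mu (mem_head _ _); rewrite leq_eqVlt ltnS leqn0 => /orP[|].
  move=> /mpoly.mdeg1P[j /eqP ->].
  exists u, (fun i => v i +
    (if i == j then mpoly.mcoeff (mpoly.mnm1 j) p else 0)).
  move=> x; rewrite big_cons uv addrCA; congr (_ + _).
  under [RHS]eq_bigr do rewrite mulrDr.
  rewrite big_split /= addrC; congr (_ + _).
  rewrite (bigD1 j) //= big1 => [|i /negbTE ij]; last first.
    by rewrite mpoly.mnm1E eq_sym ij expr0.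
  rewrite (bigD1 j) //= big1 => [|i /negbTE ->]; last by rewrite mulr0.
  by rewrite mpoly.mnm1E !eqxx expr1 mulr1 addr0 mulrC.
rewrite mpoly.mdeg_eq0 => /eqP mu0.
exists (mpoly.mcoeff mu p + u), v => x.
rewrite big_cons uv addrA big1 ?mulr1 // => i _.
by rewrite mu0 mpoly.mnmE expr0.
Qed.

Lemma Pi1_coord (R : realType) (s : nat) (i : 'I_s) :
  Pi 1 (fun x : 'rV[R]_s => x 0 i).
Proof.
exists (mpoly.mpolyX R (mpoly.mnm1 i)); split=> [|x].
  by rewrite mpoly.msizeX mpoly.mdeg1.
by rewrite mpoly.mevalXU.
Qed.

(** * Limits and parameter values *)

Lemma has_limit_near (R : realType) (s : nat) (m : int)
    (a d : 'rV[int]_s -> R) (tau : 'rV[R]_s) (g : 'rV[R]_s -> R)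
    (K : set 'rV[R]_s) (e : R) :
  has_limit m a tau d g -> compact K -> 0 < e ->
  exists N, forall r alpha, (N <= r)%N -> K (param m tau r alpha) ->
    `|g (param m tau r alpha) - iter r (subdivision m a) d alpha| < e.
Proof.
move=> [F [_ FE /fam_cvgP Fg]] cK e0.
have : nbhs (F @ \oo)%classic
    [set h | forall y, K y -> `|g y - h y| < e]%classic.
  apply: (Fg K cK); apply/uniform_nbhs.
  exists [set xy | ball xy.1 e xy.2]%classic; split=> //.
  exact: (entourage_ball _ (PosNum e0)).
move=> [N _ FN]; exists N => r alpha Nr /(FN r Nr).
by rewrite FE.
Qed.

Lemma intr_sub1_neq0 (R : realType) (m : int) :
  2 <= `|m| -> (m%:~R : R) - 1 != 0.
Proof.
move=> hm; rewrite subr_eq0 -[1]/(1%:~R) eqr_int.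
by apply/eqP => m1; move: hm; rewrite m1.
Qed.

Lemma param_originE (R : realType) (s : nat) (m : int) (tau : 'rV[R]_s) r :
  2 <= `|m| ->
  param_origin m tau r = (m%:~R ^- r - 1) *: ((m%:~R - 1)^-1 *: tau).
Proof.
move=> hm; have m0 : (m%:~R : R) != 0.
  by rewrite intr_eq0; apply/eqP => m0; move: hm; rewrite m0.
have m1 := intr_sub1_neq0 R hm.
elim: r => [|r /= ->]; first by rewrite expr0 invr1 subrr scale0r.
rewrite !scalerA -scalerBl; congr (_ *: _); rewrite exprS.
by field; rewrite m0 m1 expf_neq0.
Qed.

Lemma norm_expNz_le (R : realType) (m : int) r : 2 <= `|m| -> (0 < r)%N ->
  `|(m%:~R : R) ^- r| <= 2^-1.
Proof.
move=> hm; case: r => // r _.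
have hmR : 2 <= `|m%:~R : R|.
  by rewrite -intr_norm -[2]/(2%:~R) ler_int.
rewrite normfV lef_pV2 ?posrE ?ltr0n // ?normr_gt0; last first.
  by rewrite expf_neq0 // -normr_gt0 (lt_le_trans _ hmR).
rewrite normrX exprS -[2]mulr1 ler_pM // exprn_ege1 //.
by rewrite (le_trans _ hmR) // ler1n.
Qed.

(** Applied to the coordinate function [x_i] at the grid point of index [0], the
    convergence compares the [i]-th coordinates of the origins built from [tau]
    and from [barycenter m a]; their difference is [m^-r - 1] times a constant,
    and [`|m^-r - 1| >= 1/2]. *)
Lemma reproduces1_barycenter (R : realType) (s : nat) (m : int)
    (a : 'rV[int]_s -> R) (tau : 'rV[R]_s) :
  2 <= `|m| -> finitely_supported a -> condition_Z 2 m a ->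
  reproduces 1 m a tau -> tau = barycenter m a.
Proof.
move=> hm ha hZ [_ rep].
have m0 : m != 0 by apply/eqP => m0; move: hm; rewrite m0.
have m1 := intr_sub1_neq0 R hm.
apply/rowP => i; apply/eqP; rewrite -subr_eq0; apply/negPn/negP => tc.
set c := barycenter m a in tc.
have Pi1f := Pi1_coord R i; have af := affine_Pi1 Pi1f.
pose w := (m%:~R - 1)^-1 *: tau.
(* A segment through [0] in the direction [w] that contains every origin. *)
pose K : set 'rV[R]_s := [set t *: w | t in `[-2%:R, 2]]%classic.
have cK : compact K.
  apply: continuous_compact; last exact: segment_compact.
  by apply: continuous_subspaceT => t; apply: cvgZr_tmp; exact: cvg_id.
(* [e / 2] bounds the distance between the two coordinates from below. *)
pose e := `|(m%:~R - 1)^-1 * (tau 0 i - c 0 i)|.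
have e0 : 0 < e / 2 by rewrite divr_gt0 // normr_gt0 mulf_neq0 ?invr_eq0.
have [N HN] := has_limit_near (rep _ Pi1f) cK e0.
have small := norm_expNz_le R hm (ltn0Sn N).
set q : R := m%:~R ^- N.+1 in small.
have parE sigma : param m sigma N.+1 0 = (q - 1) *: ((m%:~R - 1)^-1 *: sigma).
  rewrite /param param_originE // -/q (_ : map_mx _ _ = 0) ?scaler0 ?addr0 //.
  by apply/rowP => k; rewrite !mxE.
have {}HN := HN N.+1 0 (leqnSn N).
rewrite (iter_subdivision_affine _ _ m0 ha (ltnSn 1) hZ af) -/c in HN.
clearbody c; rewrite !parE !mxE in HN.
have /HN : K ((q - 1) *: ((m%:~R - 1)^-1 *: tau)).
  exists (q - 1) => //=; rewrite in_itv /=.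
  by move: small; rewrite ler_norml => /andP[? ?]; apply/andP; split; lra.
rewrite -!mulrBr normrM -/e => lt.
have : 2^-1 <= `|q - 1|.
  by have := lerB_dist 1 q; rewrite normr1 distrC; lra.
move=> q1; have := ler_wpM2r (normr_ge0 _ : 0 <= e) q1.
by rewrite mulrC leNgt lt.
Qed.

Lemma barycenter_reproduces1 (R : realType) (s : nat) (m : int)
    (a : 'rV[int]_s -> R) :
  m != 0 -> finitely_supported a -> condition_Z 2 m a ->
  convergent m a (barycenter m a) -> reproduces 1 m a (barycenter m a).
Proof.
move=> m0 ha hZ cv; split=> // f /affine_Pi1 af.
exists (fun=> f); split; first by move=> _; exact: continuous_affine.
  by move=> r alpha; rewrite (iter_subdivision_affine _ _ m0 ha (ltnSn 1) hZ af).
by move=> A /nbhs_singleton Af; exists 0%N.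
Qed.

Unset Implicit Arguments.

Theorem proposition2p3 (R : realType) (s : nat) (hs : (1 <= s)%N)
  (m : int) (hm : 2 <= `|m|)
  (a : 'rV[int]_s -> R) (ha : finitely_supported a)
  (tau : 'rV[R]_s)
  (hns : non_singular m a tau)
  (hZ : condition_Z 2 m a) :
  reproduces 1 m a tau <->
  map_mx (real_complex R) tau =
    (`|m|%N%:R ^- s) *:
      \row_(i < s) partial (unit_index i) (symbol a) (const_mx 1).
Proof.
have m0 : m != 0 by apply/eqP => m0; move: hm; rewrite m0.
rewrite barycenterE //; split=> [/(reproduces1_barycenter hm ha hZ) -> //|].
move=> /rowP tauc; have {tauc} tauE : tau = barycenter m a.
  apply/rowP => i; apply: (@fmorph_inj _ _ (real_complex R)).
  by have := tauc i; rewrite !mxE.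
by rewrite tauE; apply: barycenter_reproduces1 => //; rewrite -tauE; exact: hns.1.
Qed.
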